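(* Let $D\ge 1$ and let $M_1,\ldots,M_D$ be positive integers, not all equal to $1$, and let $p\in[0,1]$. Put $N=\prod_{d=1}^{D}M_d$ and $\gamma=\sum_{d=1}^{D}(M_d-1)$. Let $\mathcal{G}_{\mathrm{lat}}$ be the $D$-dimensional lattice graph of size $M_d$ along the $d$th dimension, let $\mathcal{G}_{\mathrm{perc}}=\mathcal{G}_{\mathrm{perc}}(\mathcal{G}_{\mathrm{lat}},p)$ be the random graph obtained by independently including each link of $\mathcal{G}_{\mathrm{lat}}$ with probability $p$, and let $W=\frac{1}{\gamma}A(\mathcal{G}_{\mathrm{perc}})$. Let $F_N$ be the deterministic equivalent distribution function for the empirical spectral distribution of $W$ given by Girko's K1 equation, and let $C(z)$ be the associated $N\times N$ matrix (both defined in the context). Then for every $z$ with $\operatorname{Im}\{z\}\neq 0$ there are complex coefficients $\alpha_{i_1,\ldots,i_D}(z)$, $i_1,\ldots,i_D\in\{0,1\}$, with $$C(z)=\sum_{i_1,\ldots,i_D=0}^{1}\alpha_{i_1,\ldots,i_D}(z)\bigotimes_{d=1}^{D}Y_{d i_d},\qquad Y_{d i_d}=\begin{cases}K_{M_d}, & i_d=0,\\ I_{M_d}, & i_d=1,\end{cases}$$ such that the Stieltjes transform of $F_N$ is $$S_{F_N}(z)=\alpha_{1,\ldots,1}(z),$$ and the $2^D$ complex variables $\alpha_{i_1,\ldots,i_D}(z)$ solve the system of $2^D$ rational equations, indexed by $j_1,\ldots,j_D\in\{0,1\}$, $$\sum_{i_1,\ldots,i_D=0}^{1}\alpha_{i_1,\ldots,i_D}(z)\prod_{d=1}^{D}\lambda_{d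 i_d}(j_d)=\left(\frac{p}{\gamma}\left(\sum_{d=1}^{D}\lambda_{d0}(j_d)\right)-z-\frac{p(1-p)}{\gamma^2}\left(\sum_{d=1}^{D}(M_d-1)\right)\alpha_{1,\ldots,1}(z)\right)^{-1},$$ where $$\lambda_{d i_d}(j_d)=\begin{cases}M_d-1, & i_d=0,\ j_d=0,\\ -1, & i_d=0,\ j_d=1,\\ 1, & i_d=1.\end{cases}$$
   Context: Notation: $K_M$ is the adjacency matrix of the complete graph on $M$ vertices (ones off the diagonal, zeros on the diagonal), $I_M$ is the $M\times M$ identity matrix, $\otimes$ is the Kronecker product, and $\delta_{lj}$ is the Kronecker delta. $A(\mathcal{G})$ denotes the $0/1$ adjacency matrix of an undirected graph $\mathcal{G}$ without self-loops. $(X_{lj})_{l,j=1}^{N}$ denotes the $N\times N$ matrix with entries $X_{lj}$. Lattice graph: the nodes of $\mathcal{G}_{\mathrm{lat}}$ are the $D$-tuples in $\{1,\ldots,M_1\}\times\cdots\times\{1,\ldots,M_D\}$, and two nodes are linked if and only if their tuples differ in exactly one coordinate. With nodes ordered compatibly with the Kronecker product, its adjacency matrix is $$A(\mathcal{G}_{\mathrm{lat}})=\sum_{j=1}^{D}\bigotimes_{d=1}^{D}X_{dj},\qquad X_{dj}=\begin{cases}K_{M_d}, & j=d,\\ I_{M_d}, & j\neq d.\end{cases}$$ Percolation model: $A(\mathcal{G}_{\mathrm{perc}})$ is the random symmetric matrix whose entries on and above the diagonal are independent, being Bernoulli($p$) at positions where $A(\mathcal{G}_{\mathrm{lat}})$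 equals $1$ and $0$ elsewhere. Girko's K1 equation and deterministic equivalent: put $B=\operatorname{E}[W]$ and $H=W-\operatorname{E}[W]$. Let $L$ be the class of complex functions $X(z)$ analytic for $\operatorname{Im}\{z\}\neq 0$ with $\operatorname{Im}\{z\}\operatorname{Im}\{X(z)\}>0$. By a known theorem of Girko, the canonical system $$C_{kk}(z)=\left[\left(B-zI_N-\left(\delta_{lj}\sum_{s=1}^{N}C_{ss}(z)\operatorname{E}[H_{js}^2]\right)_{l,j=1}^{N}\right)^{-1}\right]_{kk},\qquad k=1,\ldots,N,\quad \operatorname{Im}\{z\}\neq 0,$$ has a unique solution with all $C_{kk}$ in $L$. With this solution, set $$C(z)=\left(B-zI_N-\left(\delta_{lj}\sum_{s=1}^{N}C_{ss}(z)\operatorname{E}[H_{js}^2]\right)_{l,j=1}^{N}\right)^{-1},$$ whose $k$th diagonal entry is $C_{kk}(z)$. The deterministic equivalent $F_N$ is the distribution function whose Stieltjes transform is $$S_{F_N}(z)=\int\frac{1}{x-z}\,dF_N(x)=\frac{1}{N}\sum_{k=1}^{N}C_{kk}(z),\qquad \operatorname{Im}\{z\}\neq 0.$$ *)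

(* Defs.v *)
From HB Require Import structures.
From mathcomp Require Import all_boot all_order all_algebra.
From mathcomp Require Import complex mxtens.
From mathcomp Require Import all_classical all_reals all_analysis.

Set Implicit Arguments.
Unset Strict Implicit.
Unset Printing Implicit Defensive.

Import Order.TTheory GRing.Theory Num.Theory.
Import numFieldNormedType.Exports.

Local Open Scope ring_scope.
Local Open Scope complex_scope.
Local Open Scope classical_set_scope.

(* The product M_1 * ... * M_D (see lat_sizeE), computed recursively so that
   iterated Kronecker products typecheck without casts. *)
Fixpoint lat_size (D : nat) : ('I_D -> nat) -> nat :=
  match D with
  | 0 => fun=> 1%N
  | D'.+1 => fun M => (M ord0 * lat_size (fun d => M (lift ord0 d)))%N
  end.

Lemma lat_sizeE (D : nat) (M : 'I_D -> nat) :
  lat_size M = (\prod_(d < D) M d)%N.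
Proof.
elim: D M => [|D IHD] M /=; first by rewrite big_ord0.
by rewrite IHD big_ord_recl.
Qed.

Definition lat_degree (D : nat) (M : 'I_D -> nat) : nat :=
  (\sum_(d < D) (M d - 1))%N.

Fixpoint bigtens (K : pzRingType) (D : nat) :
    forall M : 'I_D -> nat, (forall d, 'M[K]_(M d)) -> 'M[K]_(lat_size M) :=
  match D with
  | 0 => fun _ _ => 1%:M
  | D'.+1 => fun M X => tensmx (X ord0) (bigtens (fun d => X (lift ord0 d)))
  end.

Definition complete_mx (K : pzRingType) (m : nat) : 'M[K]_m :=
  \matrix_(i, j) (i != j)%:R.

(* D-tuples; coordinates are numbered from 0. *)
Definition lat_node (D : nat) (M : 'I_D -> nat) := {dffun forall d, 'I_(M d)}.

(* Position of a node in the ordering compatible with bigtens. *)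
Fixpoint node_index (D : nat) :
    forall M : 'I_D -> nat, (forall d, 'I_(M d)) -> 'I_(lat_size M) :=
  match D with
  | 0 => fun _ _ => ord0
  | D'.+1 => fun M u =>
      mxtens_index (u ord0, node_index (fun d => u (lift ord0 d)))
  end.

Definition lat_link (D : nat) (M : 'I_D -> nat) : rel (lat_node M) :=
  fun u v => #|[set d | u d != v d]%SET| == 1%N.

Definition lat_adj (K : pzRingType) (D : nat) (M : 'I_D -> nat) :
    'M[K]_(lat_size M) :=
  \matrix_(k, l) [exists u : lat_node M, exists v : lat_node M,
    [&& node_index u == k, node_index v == l & lat_link u v]]%:R.

Lemma bigtensE (K : comPzRingType) (D : nat) (M : 'I_D -> nat)
    (X : forall d, 'M[K]_(M d)) (u v : forall d, 'I_(M d)) :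
  bigtens X (node_index u) (node_index v) = \prod_(d < D) X d (u d) (v d).
Proof.
elim: D M X u v => [|D IHD] M X u v /=; first by rewrite mxE eqxx big_ord0.
by rewrite tensmxE IHD big_ord_recl.
Qed.

Lemma node_index_inj (D : nat) (M : 'I_D -> nat) (u v : forall d, 'I_(M d)) :
  node_index u = node_index v -> forall d, u d = v d.
Proof.
elim: D M u v => [|D IHD] M u v /=; first by move=> _ [].
move=> /(congr1 (@mxtens_unindex _ _)); rewrite !mxtens_indexK => -[] u0 uS d.
by case: (unliftP ord0 d) => [d' ->|->]; [exact: (IHD _ _ _ uS)|exact: u0].
Qed.

Lemma node_index_surj (D : nat) (M : 'I_D -> nat) (k : 'I_(lat_size M)) :
  exists u : lat_node M, k = node_index u.
Proof.
have inj : injective (fun u : lat_node M => node_index u).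
  by move=> u v /node_index_inj uv; apply/ffunP.
have /codomP[u ->] : k \in codom (fun u : lat_node M => node_index u).
  apply: inj_card_onto inj _ _.
  rewrite card_ord lat_sizeE card_dep_ffun foldrE big_map big_enum /=.
  by under [leqRHS]eq_bigr do rewrite card_ord.
by exists u.
Qed.

(* The Kronecker form of the adjacency matrix, checking that node_index orders
   the nodes compatibly with bigtens. *)
Lemma lat_adjE (K : comPzRingType) (D : nat) (M : 'I_D -> nat) :
  lat_adj K M = \sum_(j < D) bigtens (fun d : 'I_D =>
    if d == j then complete_mx K (M d) else 1%:M).
Proof.
apply/matrixP => k l; have [u ->] := node_index_surj k.
have [v ->] := node_index_surj l; rewrite mxE summxE.
under eq_bigr => j _ do rewrite bigtensE (bigD1 j) //= eqxx mxE.
have -> : [exists u' : lat_node M, exists v' : lat_node M,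
    [&& node_index u' == node_index u, node_index v' == node_index v
      & lat_link u' v']] = lat_link u v.
  apply/existsP/idP => [[u' /existsP[v' /and3P[/eqP uu /eqP vv]]]|uv].
    have -> : u' = u by apply/ffunP; exact: node_index_inj uu.
    by have -> : v' = v by apply/ffunP; exact: node_index_inj vv.
  by exists u; apply/existsP; exists v; rewrite !eqxx.
have term j : (u j != v j)%:R * \prod_(i < D | i != j)
      (if i == j then complete_mx K (M i) else 1%:M) (u i) (v i) =
    ([set d | u d != v d]%SET == [set j]%SET)%:R :> K.
  have [uv|nuv] := eqVneq [set d | u d != v d]%SET [set j]%SET.
    have /setP uvE := uv; have := uvE j; rewrite !inE eqxx => -> /=.
    rewrite mul1r big1 // => i ij; rewrite (negPf ij) mxE.
    by have := uvE i; rewrite !inE (negPf ij) => /negbFE ->.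
  have [uvj|] := eqVneq (u j) (v j); first by rewrite /= mul0r.
  move=> uvj; rewrite mul1r; apply/eqP.
  have [i ij uvi] : exists2 i, i != j & u i != v i.
    apply/exists_inP; apply: contraNT nuv; rewrite negb_exists_in.
    move=> /forall_inP uvi; apply/eqP/setP => i; rewrite !inE.
    by have [->|/uvi /negPf] := eqVneq i j.
  by rewrite (bigD1 i) //= (negPf ij) mxE (negPf uvi) mul0r.
under eq_bigr do rewrite term.
rewrite /lat_link; case: (boolP (_ == 1%N)) => [/cards1P[j ->]|uv1].
  rewrite (bigD1 j) //= eqxx big1 ?addr0 // => i ij.
  by rewrite (inj_eq set1_inj) eq_sym (negPf ij).
rewrite big1 // => i _; case: eqP => // uvi.
by move: uv1; rewrite uvi cards1.
Qed.

Section Percolation.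
Context (R : realType) (d : measure_display) (T : measurableType d)
  (P : probability T R).

Definition mutually_independent (I : finType) (X : I -> {RV P >-> R}) : Prop :=
  forall (J : {set I}) (E : I -> set R),
    (forall i, i \in J -> measurable (E i)) ->
    P (\bigcap_(i in [set` J]) X i @^-1` E i) =
      (\prod_(i in J) P (X i @^-1` E i))%E.

Definition bernoulli_RV (p : R) (X : {RV P >-> R}) : Prop :=
  forall U : set R, measurable U ->
    distribution P X U = bernoulli_prob p [set b : bool | U b%:R].

Definition percolation (D : nat) (M : 'I_D -> nat) (p : R)
    (A : 'I_(lat_size M) -> 'I_(lat_size M) -> {RV P >-> R}) : Prop :=
  [/\ forall k l t, A k l t = A l k t,
      mutually_independent
        (fun kl : {kl : 'I_(lat_size M) * 'I_(lat_size M) | (kl.1 <= kl.2)%N} =>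
           A (val kl).1 (val kl).2),
      forall k l, lat_adj R M k l = 1 -> bernoulli_RV p (A k l) &
      forall k l t, lat_adj R M k l <> 1 -> A k l t = 0].

Definition mean_mx (n : nat) (W : T -> 'M[R]_n) : 'M[R]_n :=
  \matrix_(k, l) fine 'E_P[fun t => W t k l].

(* E[H_js^2] for H = W - E[W]. *)
Definition variance_mx (n : nat) (W : T -> 'M[R]_n) : 'M[R]_n :=
  mean_mx (fun t => map_mx (fun h : R => h ^+ 2) (W t - mean_mx W)).

End Percolation.

Section Girko.
Context (R : realType).

(* Analyticity is complex differentiability at every point of the open set
   Im z != 0; R[i]^o is R[i] as a normed module over itself. *)
Definition girko_class (X : R[i] -> R[i]) : Prop :=
  forall z, complex.Im z != 0 ->
    derivable (X : R[i]^o -> R[i]^o) z 1 /\ 0 < complex.Im z * complex.Im (X z).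

Definition girko_pencil (n : nat) (B V : 'M[R]_n) (c : 'I_n -> R[i] -> R[i])
    (z : R[i]) : 'M[R[i]]_n :=
  map_mx (fun b : R => b%:C) B - z%:M
  - \matrix_(l, j) ((l == j)%:R * \sum_(s < n) c s z * (V j s)%:C).

Definition girko_mx (n : nat) (B V : 'M[R]_n) (c : 'I_n -> R[i] -> R[i])
    (z : R[i]) : 'M[R[i]]_n := invmx (girko_pencil B V c z).

(* The solution of the canonical system in the class L.  As invmx is the
   identity on singular matrices, invertibility is part of solving it. *)
Definition girko_solution (n : nat) (B V : 'M[R]_n) (c : 'I_n -> R[i] -> R[i]) :
    Prop :=
  (forall k, girko_class (c k)) /\
  (forall z, complex.Im z != 0 -> girko_pencil B V c z \in unitmx /\
     forall k, c k z = girko_mx B V c z k k).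

Definition stieltjes (F : cumulativeBounded (0 : R) (1 : R)) (z : R[i]) : R[i] :=
  (\int[lebesgue_stieltjes_measure F]_(x in setT) complex.Re ((x%:C - z)^-1)) +i*
  (\int[lebesgue_stieltjes_measure F]_(x in setT) complex.Im ((x%:C - z)^-1)).

Definition deterministic_equivalent (n : nat) (c : 'I_n -> R[i] -> R[i])
    (F : cumulativeBounded (0 : R) (1 : R)) : Prop :=
  forall z, complex.Im z != 0 -> stieltjes F z = n%:R^-1 * \sum_(k < n) c k z.

End Girko.

Definition lat_factor (K : pzRingType) (m : nat) (i : 'I_2) : 'M[K]_m :=
  if i == 0 then complete_mx K m else 1%:M.

(* Eigenvalue of lat_factor K m i on the all-ones vector (j = 0) and on its
   orthogonal complement (j = 1), which is trivial when m = 1. *)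
Definition lat_eigenvalue (K : pzRingType) (m : nat) (i j : 'I_2) : K :=
  if i == 0 then (if j == 0 then m%:R - 1 else -1) else 1.

(* Main.v *)
Require Import Defs.
From mathcomp Require Import all_boot all_order perm all_algebra.
From mathcomp Require Import complex mxtens.
From mathcomp Require Import all_classical all_reals all_analysis.
From mathcomp Require Import measurable_realfun ring.

Set Implicit Arguments.
Unset Strict Implicit.
Unset Printing Implicit Defensive.

Import Order.TTheory GRing.Theory Num.Theory.
Import numFieldNormedType.Exports ComplexField.Normc.

Local Open Scope ring_scope.
Local Open Scope complex_scope.

(** Write [L] for the adjacency matrix of the lattice graph and [g] for the
    inverse of its degree.  Each admissible entry of the percolation matrix is
    Bernoulli, so [E[W] = p g L] and the matrix of variances is
    [p (1 - p) g^2 L] ([percolation_mean], [percolation_variance]).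

    The heart of the matter is that the diagonal solution of the canonical
    system is constant.  The lattice graph is vertex-transitive: transposing
    values in each coordinate separately moves any node to any other node
    ([lat_vertex_transitive]).  Composing a solution with an automorphism gives
    another solution, so it suffices that at each [z] off the real axis the
    system has only one solution with imaginary parts on the side of [z]
    ([canonical_system_unique]).  If [G] and [G'] are the resolvents of two
    solutions [c] and [c'], the resolvent identity bounds [|c - c'|] entrywise
    by its image under the nonnegative matrix [(|G| o |G'|) V], where [o] is the
    entrywise product.  The same identity applied to [c] and to its complex
    conjugate gives, for [v = Im z * Im c],
      [v_k = \sum_l |G_kl|^2 ((Im z)^2 + (V v)_l)],
    so that [v] is strictly decreased by [(|G| o |G|) V].  A weighted Schur
    test, with weights the square roots of [v_k v'_k], then shows that
    [(|G| o |G'|) V] is a strict contraction, whence [c = c']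
    ([weighted_schur]).

    With a constant diagonal [s], the rows of [V] having constant sum, the
    pencil to be inverted is a polynomial of degree one in [L]
    ([lat_pencil]).  The matrices [K_M] and [I_M] are combinations of the
    projector [J/M] on the constants and of its complement, so tensor products
    of these projectors diagonalise [L], and the inverse of the pencil is
    obtained by inverting each eigenvalue.  Expanding the projectors again in
    [K_M] and [I_M] produces the coefficients [alpha]
    ([lat_spectral_coefE]); the equations say that these coefficients evaluate
    to the prescribed inverse eigenvalues
    ([lat_spectral_coef_eigenvalue]), and [alpha_{1,...,1}] is the common
    diagonal entry [s] because [K_M] has zero diagonal
    ([lat_expansion_diag]). *)

(** * Supersolutions and a weighted Schur test *)

Section WeightedSchur.
Context (R : realType) (n : nat) (V : 'I_n -> 'I_n -> R) (y : R).
Hypotheses (V_ge0 : forall l s, 0 <= V l s) (y_gt0 : 0 < y).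

(** Positivity of [t] forces some [a l] to be nonzero, and that
    entry pays the strictly positive cost [a l ^+ 2 * y]. *)
Lemma damped_row_lt (a v : 'I_n -> R) (t : R) : 0 < t ->
  t = \sum_l a l ^+ 2 * (y + \sum_s V l s * v s) ->
  \sum_l a l ^+ 2 * (\sum_s V l s * v s) < t.
Proof.
move=> t_gt0 tE.
have [[l al0]|a0] := pselect (exists l, a l != 0); last first.
  have a_eq0 l : a l = 0 by apply: contra_notP a0 => /eqP al; exists l.
  move: t_gt0; rewrite {1}tE big1 ?ltxx // => l _.
  by rewrite a_eq0 expr0n mul0r.
rewrite tE; under [ltRHS]eq_bigr do rewrite mulrDr.
rewrite big_split /= ltrDr -mulr_suml mulr_gt0 //.
rewrite (bigD1 l) //= ltr_pwDl //.
  by rewrite exprn_even_gt0.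
by apply: sumr_ge0 => i _; rewrite sqr_ge0.
Qed.

(** [v] and [v'] are strict supersolutions for the kernels [a ^ 2 V] and
    [a' ^ 2 V]; by the arithmetic-geometric inequality their geometric mean is
    one for the mixed kernel [a a' V].  At an index where [e] is largest
    relative to this geometric mean, a nonzero [e] would be smaller than
    itself. *)
Lemma weighted_schur (a a' : 'I_n -> 'I_n -> R) (v v' e : 'I_n -> R) :
  (forall k l, 0 <= a k l) -> (forall k l, 0 <= a' k l) ->
  (forall k, 0 < v k) -> (forall k, 0 < v' k) -> (forall k, 0 <= e k) ->
  (forall k, v k = \sum_l a k l ^+ 2 * (y + \sum_s V l s * v s)) ->
  (forall k, v' k = \sum_l a' k l ^+ 2 * (y + \sum_s V l s * v' s)) ->
  (forall k, e k <= \sum_l a k l * a' k l * (\sum_s V l s * e s)) ->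
  forall k, e k = 0.
Proof.
move=> a0 a'0 v0 v'0 e0 vE v'E eE k0.
pose w k := Num.sqrt (v k); pose w' k := Num.sqrt (v' k).
have w0 k : 0 < w k by rewrite sqrtr_gt0.
have w'0 k : 0 < w' k by rewrite sqrtr_gt0.
have w2 k : w k ^+ 2 = v k by rewrite sqr_sqrtr // ltW.
have w'2 k : w' k ^+ 2 = v' k by rewrite sqr_sqrtr // ltW.
pose r k := e k / (w k * w' k).
have rE k : e k = r k * (w k * w' k) by rewrite divfK // gt_eqF // mulr_gt0.
have r0 k : 0 <= r k by rewrite divr_ge0 // mulr_ge0 // ltW.
have [k _ kmax] := @arg_maxP _ _ _ k0 predT r isT.
suff rk0 : r k = 0.
  have : r k0 <= 0 by rewrite -rk0; exact: kmax.
  rewrite rE => rk0_le0; suff -> : r k0 = 0 by rewrite mul0r.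
  by apply/eqP; rewrite eq_le rk0_le0 r0.
apply/eqP; apply: contraT => rk; have {}rk : 0 < r k by rewrite lt_def rk r0.
pose t := \sum_l a k l * a' k l * (\sum_s V l s * (w s * w' s)).
have ekt : e k <= r k * t.
  apply: le_trans (eE k) _; rewrite mulr_sumr; apply: ler_sum => l _.
  rewrite mulrCA; apply: ler_wpM2l; first exact: mulr_ge0.
  rewrite mulr_sumr; apply: ler_sum => s _; rewrite mulrCA.
  apply: ler_wpM2l => //.
  rewrite rE; apply: ler_wpM2r; last exact: kmax.
  by rewrite mulr_ge0 // ltW.
have wt : w k * w' k <= t by move: ekt; rewrite {1}rE ler_pM2l.
(* The arithmetic-geometric inequality term by term, scaled so that the two
   squares carry the weights v' k and v k of the opposite solution. *)
have amgm : 2 * (w k * w' k) * t <=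
    v' k * (\sum_l a k l ^+ 2 * (\sum_s V l s * v s)) +
    v k * (\sum_l a' k l ^+ 2 * (\sum_s V l s * v' s)).
  rewrite !mulr_sumr -big_split; apply: ler_sum => l _ /=.
  rewrite !mulr_sumr -big_split; apply: ler_sum => s _ /=.
  rewrite -!w2 -!w'2.
  have : 0 <= V l s * (w' k * a k l * w s - w k * a' k l * w' s) ^+ 2.
    by rewrite mulr_ge0 // sqr_ge0.
  by rewrite -subr_ge0; congr (0 <= _); ring.
have lt1 := damped_row_lt (v0 k) (vE k).
have lt2 := damped_row_lt (v'0 k) (v'E k).
rewrite -(ltr_pM2l (v'0 k)) in lt1; rewrite -(ltr_pM2l (v0 k)) in lt2.
have := le_lt_trans amgm (ltrD lt1 lt2); rewrite -w2 -w'2 => /lt_geF <-.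
have -> : w' k ^+ 2 * w k ^+ 2 + w k ^+ 2 * w' k ^+ 2 =
  2 * (w k * w' k) * (w k * w' k) by ring.
by rewrite ler_wpM2l // mulr_ge0 // ltW // mulr_gt0.
Qed.
End WeightedSchur.

(** * Uniqueness for the canonical system *)

Section Normc.
Context (R : realType).
Implicit Type x : R[i].

Lemma normc_ge0 x : 0 <= normc x.
Proof. by case: x => a b; rewrite sqrtr_ge0. Qed.

Lemma normcR (r : R) : normc r%:C = `|r|.
Proof. by rewrite /= expr0n addr0 sqrtr_sqr. Qed.

Lemma normc_sum (I : finType) (f : I -> R[i]) :
  normc (\sum_i f i) <= \sum_i normc (f i).
Proof.
elim/big_ind2: _ => [|x r y s xr ys|//]; first by rewrite normc0.
exact: le_trans (le_normcD _ _) (lerD xr ys).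
Qed.
End Normc.

Section Canonical.
Context (R : realType) (n : nat) (B V : 'M[R]_n).
Implicit Types (c : 'I_n -> R[i] -> R[i]) (z : R[i]).

(** This is [Q^-1 - Q'^-1 = Q^-1 (Q' - Q) Q'^-1] on the diagonal: two pencils
    with the same [B] and [V] differ by a diagonal matrix.  The two points [z]
    and [z'] are independent so as to allow [z' = conjc z] as well as
    [z' = z]. *)
Lemma girko_resolvent c c' z z' k :
  girko_pencil B V c z \in unitmx -> girko_pencil B V c' z' \in unitmx ->
  girko_mx B V c z k k - girko_mx B V c' z' k k =
  \sum_l girko_mx B V c z k l * girko_mx B V c' z' l k *
    (z - z' + \sum_s (c s z - c' s z') * (V l s)%:C).
Proof.
rewrite /girko_mx; set Q := girko_pencil B V c z.
set Q' := girko_pencil B V c' z'.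
move=> uQ uQ'.
pose x := \row_l (z - z' + \sum_s (c s z - c' s z') * (V l s)%:C).
have QQ : Q' - Q = diag_mx x.
  apply/matrixP => i j; rewrite !mxE eq_sym.
  case: (eqVneq j i) => [->|ji]; last by rewrite !mulr0n !mul0r; ring.
  rewrite !mulr1n !mul1r.
  under [X in _ = _ + X]eq_bigr do rewrite mulrBl.
  by rewrite sumrB; ring.
have /matrixP /(_ k k) : invmx Q - invmx Q' = invmx Q *m diag_mx x *m invmx Q'.
  by rewrite -QQ mulmxBr mulmxBl mulVmx // mul1mx -mulmxA mulmxV // mulmx1.
rewrite mxE [X in _ + X]mxE => ->; rewrite mxE; apply: eq_bigr => l _.
by rewrite mul_mx_diag !mxE mulrAC.
Qed.

Lemma girko_pencil_conj c z :
  map_mx (@conjc R) (girko_pencil B V c z) =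
  girko_pencil B V (fun k _ => conjc (c k z)) (conjc z).
Proof.
apply/matrixP => i j; rewrite !mxE !rmorphB rmorphM /= conjc_nat rmorph_sum /=.
rewrite rmorphMn oppr0; congr (_ - _ - _ * _).
by apply: eq_bigr => s _; rewrite rmorphM /= oppr0.
Qed.

Lemma girko_mx_sym c z k l : B^T = B ->
  girko_mx B V c z k l = girko_mx B V c z l k.
Proof.
move=> Bsym; suff {2}-> : girko_mx B V c z = (girko_mx B V c z)^T.
  by rewrite mxE.
rewrite trmx_inv; congr invmx; apply/matrixP => i j.
have /matrixP/(_ i j) := Bsym; rewrite !mxE => ->; rewrite [j == i]eq_sym.
by case: eqVneq => [->|]; rewrite ?mul0r.
Qed.

Lemma mul_conjc (x : R[i]) : x * conjc x = (normc x ^+ 2)%:C.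
Proof.
case: x => a b; apply/eqP.
rewrite eq_complex /= sqr_sqrtr ?addr_ge0 ?sqr_ge0 //.
by apply/andP; split; apply/eqP; ring.
Qed.

(** The resolvent identity between the pencil and its conjugate: as the
    resolvent is symmetric, the products [G k l * (conjc G) l k] are squared
    norms. *)
Lemma girko_im c z k : B^T = B -> girko_pencil B V c z \in unitmx ->
  complex.Im (girko_mx B V c z k k) =
  \sum_l normc (girko_mx B V c z k l) ^+ 2 *
    (complex.Im z + \sum_s V l s * complex.Im (c s z)).
Proof.
move=> Bsym uQ.
pose c' k := fun _ : R[i] => conjc (c k z).
have uQ' : girko_pencil B V c' (conjc z) \in unitmx.
  by rewrite -girko_pencil_conj map_unitmx.
have := girko_resolvent k uQ uQ'.
have -> : girko_mx B V c' (conjc z) = map_mx (@conjc R) (girko_mx B V c z).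
  by rewrite /girko_mx map_invmx girko_pencil_conj.
rewrite mxE subcJ.
have -> : \sum_l girko_mx B V c z k l *
    map_mx (@conjc R) (girko_mx B V c z) l k *
    (z - conjc z + \sum_s (c s z - c' s (conjc z)) * (V l s)%:C) =
  2%:R * (\sum_l normc (girko_mx B V c z k l) ^+ 2 *
    (complex.Im z + \sum_s V l s * complex.Im (c s z)))%:C * 'i%C.
  rewrite rmorph_sum mulr_sumr mulr_suml; apply: eq_bigr => l _.
  rewrite (rmorphM (real_complex R)) mxE (girko_mx_sym _ _ l k Bsym).
  rewrite mul_conjc subcJ (rmorphM (real_complex R)) (rmorphD (real_complex R)).
  rewrite (rmorph_sum (real_complex R)) /=.
  have -> : \sum_s (c s z - c' s (conjc z)) * (V l s)%:C =
      2%:R * (\sum_s (V l s * complex.Im (c s z))%:C) * 'i%C.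
    rewrite mulr_sumr mulr_suml; apply: eq_bigr => s _.
    by rewrite subcJ rmorphM /=; ring.
  by ring.
have i0 : 'i%C != 0 :> R[i] by rewrite eq_complex /= oner_eq0 andbF.
by move=> /(mulIf i0) /(mulfI _) /complexI ->; rewrite // pnatr_eq0.
Qed.

(** Uniqueness holds separately at each point [z]: the resolvent identity for
    two solutions at the same [z] puts their difference in the scope of the weighted
    Schur test, with [Im z * Im c] and [Im z * Im c'] as supersolutions. *)
Lemma canonical_system_unique c c' z : B^T = B -> (forall l s, 0 <= V l s) ->
  complex.Im z != 0 ->
  (forall k, 0 < complex.Im z * complex.Im (c k z)) ->
  (forall k, 0 < complex.Im z * complex.Im (c' k z)) ->
  girko_pencil B V c z \in unitmx -> girko_pencil B V c' z \in unitmx ->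
  (forall k, c k z = girko_mx B V c z k k) ->
  (forall k, c' k z = girko_mx B V c' z k k) ->
  forall k, c k z = c' k z.
Proof.
move=> Bsym V0 z0 ic ic' u u' cE c'E k; apply/eqP; rewrite -subr_eq0; apply/eqP.
apply: eq0_normc.
(* girko_im multiplied by Im z, which makes all quantities positive whatever
   the side of the real axis. *)
have imE (x : 'I_n -> R[i] -> R[i]) : girko_pencil B V x z \in unitmx ->
    (forall k, x k z = girko_mx B V x z k k) ->
    forall k, complex.Im z * complex.Im (x k z) =
  \sum_l normc (girko_mx B V x z k l) ^+ 2 *
    (complex.Im z ^+ 2 + \sum_s V l s * (complex.Im z * complex.Im (x s z))).
  move=> ux xE k'; rewrite {1}xE girko_im // mulr_sumr; apply: eq_bigr => l _.
  rewrite mulrCA mulrDr expr2 mulr_sumr; congr (_ * (_ + _)).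
  by apply: eq_bigr => s _; rewrite mulrCA.
apply: (weighted_schur V0 _ _ _ ic ic' _ (imE _ u cE) (imE _ u' c'E)
  (e := fun k => normc (c k z - c' k z))) => //.
- by rewrite exprn_even_gt0.
- by move=> *; apply: normc_ge0.
- by move=> *; apply: normc_ge0.
- by move=> *; apply: normc_ge0.
move=> k'; rewrite [in leLHS]cE [in leLHS]c'E girko_resolvent //.
apply: le_trans (normc_sum _) _; apply: ler_sum => l _.
rewrite subrr add0r !normcM (girko_mx_sym _ _ l) //.
rewrite ler_wpM2l ?mulr_ge0 ?normc_ge0 //.
apply: le_trans (normc_sum _) _; apply: ler_sum => s _.
by rewrite normcM normcR ger0_norm // mulrC.
Qed.
End Canonical.

Lemma mulmx1_invmx (K : comUnitRingType) (n : nat) (A B : 'M[K]_n) :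
  A *m B = 1%:M -> A \in unitmx /\ invmx A = B.
Proof.
move=> AB; have [uA _] := mulmx1_unit AB.
by split=> //; rewrite -[LHS]mulmx1 -AB mulmxA mulVmx // mul1mx.
Qed.

Section Symmetry.
Context (R : realType) (n : nat) (B V : 'M[R]_n).

(** Relabelling the indices by an automorphism of [B] and [V] turns a solution
    into a solution, so uniqueness makes every solution invariant. *)
Lemma canonical_solution_aut (c : 'I_n -> R[i] -> R[i]) (s : {perm 'I_n}) z k :
  B^T = B -> (forall a b, 0 <= V a b) -> girko_solution B V c ->
  (forall a b, B (s a) (s b) = B a b) -> (forall a b, V (s a) (s b) = V a b) ->
  complex.Im z != 0 -> c (s k) z = c k z.
Proof.
move=> Bsym V0 [cL cS] Bs Vs z0; have [uQ cE] := cS z z0.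
pose c' (a : 'I_n) := c (s a).
have QE a b : girko_pencil B V c' z a b = girko_pencil B V c z (s a) (s b).
  rewrite !mxE (inj_eq perm_inj) Bs [in RHS](reindex_inj (@perm_inj _ s)).
  by under [in RHS]eq_bigr do rewrite Vs.
have [uQ' GE] : girko_pencil B V c' z \in unitmx /\
    invmx (girko_pencil B V c' z) = \matrix_(a, b) girko_mx B V c z (s a) (s b).
  apply: mulmx1_invmx; apply/matrixP => a b.
  have /matrixP/(_ (s a) (s b)) := mulmxV uQ.
  rewrite !mxE (inj_eq perm_inj) [in LHS](reindex_inj (@perm_inj _ s)) /= => <-.
  by apply: eq_bigr => i _; rewrite QE; congr (_ * _); rewrite mxE.
apply: (@canonical_system_unique _ _ _ _ c' c z Bsym V0 z0) => // [a|a|a].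
- by have [_] := cL (s a) z z0.
- by have [_] := cL a z z0.
- by rewrite /c' cE /girko_mx GE mxE.
Qed.
End Symmetry.

(** * Mean and variance of the percolation matrix *)

Section Bernoulli.
Context (R : realType) (d : measure_display) (T : measurableType d)
  (P : probability T R) (p : R).
Hypothesis p01 : 0 <= p <= 1.
Local Open Scope classical_set_scope.

(** A Bernoulli variable is almost surely the indicator of the event that it
    equals 1, and on the values 0 and 1 every [f] is affine. *)
Lemma bernoulli_expectation (X : {RV P >-> R}) (f : R -> R) :
  bernoulli_RV p X -> measurable_fun setT f ->
  ('E_P[fun t => f (X t)])%E = (p * f 1 + (1 - p) * f 0)%:E.
Proof.
move=> bX mf.
pose E := X @^-1` [set 1].
have mE : measurable E by exact: measurable_funPTI.
have PE : P E = p%:E.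
  rewrite -[P E]/(distribution P X [set 1]) bX // bernoulli_probE //.
  rewrite !diracE mem_set //= memNset /= ?mule1 ?mule0 ?adde0 //.
  by move=> /esym/eqP; rewrite oner_eq0.
have aeX : {ae P, forall t, X t = (\1_E t : R)}.
  exists (X @^-1` (~` [set 0; 1])); split.
  - by apply: measurable_funPTI; apply: measurableC; apply: measurableU.
  - rewrite -[LHS]/(distribution P X _) bX; last first.
      by apply: measurableC; apply: measurableU.
    rewrite bernoulli_probE // !diracE !memNset /= ?mule0 ?adde0 //; apply.
      by left.
    by right.
  - move=> t; apply: contra_not => /= Xt.
    rewrite indicE /E; case: Xt => Xt; last by rewrite mem_set.
    by rewrite memNset //= Xt => /esym/eqP; rewrite oner_eq0.
have LE : (\1_E : T -> R) \in Lfun P 1.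
  by apply/Lfun1_integrable; apply: integrable_indic => //; rewrite PE ltry.
transitivity ('E_P[(((f 1 - f 0)%R \o* \1_E) \+ cst (f 0))%R])%E.
  rewrite unlock; apply: ae_eq_integral => //.
  - by apply/measurable_EFinP; apply: measurableT_comp.
  - apply/measurable_EFinP; apply: measurable_funD => //.
    by apply: measurable_funM.
  - apply: filterS aeX => t -> _ /=; congr EFin.
    by rewrite indicE; case: (t \in E); rewrite ?mulr1n ?mulr0n; ring.
rewrite expectationD ?expectationZl //; last 2 first.
  exact: Lfun_scale.
  exact: Lfun_cst.
rewrite expectation_cst expectation_indic // PE -EFinM -EFinD; congr EFin.
ring.
Qed.

Variables (D : nat) (M : 'I_D -> nat).
Variable A : 'I_(lat_size M) -> 'I_(lat_size M) -> {RV P >-> R}.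
Hypothesis A_perc : percolation p A.
Variable W : T -> 'M[R]_(lat_size M).
Variable g : R.
Hypothesis W_def : forall t, W t = g *: \matrix_(k, l) A k l t.

(** Off the links the entry vanishes; the factor [lat_adj R M k l], which is 0
    or 1, treats both cases in one formula. *)
Lemma percolation_expectation k l (f : R -> R) : measurable_fun setT f ->
  ('E_P[fun t => f (A k l t)])%E = (f 0 + p * (f 1 - f 0) * lat_adj R M k l)%:E.
Proof.
case: A_perc => _ _ A1 A0 mf.
have [a1|a1] := eqVneq (lat_adj R M k l) 1.
  by rewrite bernoulli_expectation // ?a1; [congr EFin; ring | exact: A1].
have a0 : lat_adj R M k l = 0.
  by move: a1; rewrite mxE; case: [exists _, _]; rewrite ?eqxx.
rewrite a0 mulr0 addr0 -[RHS](expectation_cst P); congr expectation.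
by apply/funext => t; rewrite A0 //; apply/eqP.
Qed.

Lemma percolation_mean : mean_mx P W = (p * g) *: lat_adj R M.
Proof.
apply/matrixP => k l; rewrite mxE.
have -> : (fun t => W t k l) = (fun t => (g * A k l t)).
  by apply/funext => t; rewrite W_def !mxE.
rewrite (@percolation_expectation k l (fun x => g * x)) /=; last first.
  exact: measurable_funM.
by rewrite [RHS]mxE; ring.
Qed.

Lemma percolation_variance :
  variance_mx P W = (p * (1 - p) * g ^+ 2) *: lat_adj R M.
Proof.
apply/matrixP => k l; rewrite mxE percolation_mean.
set b := lat_adj R M k l.
have -> : (fun t =>
    map_mx (fun h : R => h ^+ 2) (W t - (p * g) *: lat_adj R M) k l) =
    (fun t => ((g * A k l t - p * g * b) ^+ 2)).
  by apply/funext => t; rewrite W_def /b !mxE.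
pose f x := (g * x - p * g * b) ^+ 2.
rewrite (@percolation_expectation k l f) /f /=; last first.
  by apply: measurable_funX; apply: measurable_funB.
rewrite [RHS]mxE -/b.
have : b = 0 \/ b = 1 by rewrite /b mxE; case: [exists _, _]; [right|left].
by case=> ->; ring.
Qed.
End Bernoulli.

(** * Spectral decomposition of the lattice graph *)

Section Tensor.
Context (K : comPzRingType) (D : nat) (M : 'I_D -> nat).
Implicit Types X Y : forall d, 'M[K]_(M d).

Lemma eq_bigtens X Y : (forall d, X d = Y d) -> bigtens X = bigtens Y.
Proof. by move=> XY; congr bigtens; apply: functional_extensionality_dep. Qed.

Lemma bigtens_sum (I : finType) (a : 'I_D -> I -> K)
    (Y : forall d, I -> 'M[K]_(M d)) :
  bigtens (fun d => \sum_i a d i *: Y d i) =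
  \sum_(f : {ffun 'I_D -> I})
    (\prod_d a d (f d)) *: bigtens (fun d => Y d (f d)).
Proof.
apply/matrixP => k l; have [u ->] := node_index_surj k.
have [v ->] := node_index_surj l; rewrite bigtensE summxE.
under eq_bigr do rewrite summxE; rewrite bigA_distr_bigA /=.
apply: eq_bigr => f _; rewrite mxE bigtensE -big_split /=.
by apply: eq_bigr => d _; rewrite mxE.
Qed.

Lemma bigtensZ (a : 'I_D -> K) X :
  bigtens (fun d => a d *: X d) = (\prod_d a d) *: bigtens X.
Proof.
apply/matrixP => k l; have [u ->] := node_index_surj k.
have [v ->] := node_index_surj l; rewrite mxE !bigtensE -big_split /=.
by apply: eq_bigr => d _; rewrite mxE.
Qed.

Lemma bigtens1 : bigtens (fun d => 1%:M : 'M[K]_(M d)) = 1%:M.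
Proof.
apply/matrixP => k l; have [u ->] := node_index_surj k.
have [v ->] := node_index_surj l; rewrite mxE bigtensE.
have [/node_index_inj uv|uv] := eqVneq (node_index u) (node_index v).
  by rewrite big1 // => d _; rewrite mxE uv eqxx.
have [d ud] : exists d, u d != v d.
  apply/existsP; apply: contraNT uv; rewrite negb_exists => /forallP uv.
  apply/eqP; congr node_index.
  by apply: functional_extensionality_dep => d; apply/eqP/negbNE/uv.
by rewrite (bigD1 d) //= mxE (negPf ud) mul0r.
Qed.
End Tensor.

Lemma bigtens_mul (K : comPzRingType) (D : nat) (M : 'I_D -> nat)
    (X Y : forall d, 'M[K]_(M d)) :
  bigtens X *m bigtens Y = bigtens (fun d => X d *m Y d).
Proof.
elim: D M X Y => [|D IHD] M X Y /=; first by rewrite mulmx1.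
by rewrite tensmx_mul IHD.
Qed.

Section Factor.
Context (K : fieldType) (m : nat).
Hypothesis m0 : m%:R != 0 :> K.

(** Coordinates, in the basis [K_m], [I_m], of the projector [J / m] on the
    constants ([j = 0]) and of its complement ([j = 1]). *)
Definition lat_coef (i j : 'I_2) : K :=
  if j == 0 then m%:R^-1 else if i == 0 then - m%:R^-1 else 1 - m%:R^-1.

Definition lat_proj (j : 'I_2) : 'M[K]_m :=
  \sum_i lat_coef i j *: lat_factor K m i.

Lemma sum_ord2 (V : nmodType) (F : 'I_2 -> V) : \sum_i F i = F 0 + F 1.
Proof.
by rewrite !big_ord_recl big_ord0 addr0; congr (_ + F _); apply/val_inj.
Qed.

Lemma sum_lat_proj : \sum_j lat_proj j = 1%:M.
Proof.
rewrite /lat_proj !sum_ord2 /lat_coef /lat_factor /= addrACA -!scalerDl.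
by rewrite subrr scale0r add0r subrKC scale1r.
Qed.

Lemma complete_mx_sqr :
  complete_mx K m *m complete_mx K m =
  (m%:R - 1)%:M + (m%:R - 1 - 1) *: complete_mx K m.
Proof.
have -> : complete_mx K m = const_mx 1 - 1%:M.
  by apply/matrixP => i j; rewrite !mxE; case: eqVneq; rewrite ?subrr ?subr0.
have JJ : (const_mx 1 : 'M[K]_m) *m (const_mx 1 : 'M[K]_m) =
    m%:R *: const_mx 1.
  apply/matrixP => i j; rewrite !mxE; under eq_bigr do rewrite !mxE mul1r.
  by rewrite sumr_const card_ord mulr1.
rewrite mulmxBl mulmxBr mul1mx mulmx1 JJ; apply/matrixP => i j; rewrite !mxE.
by case: (i == j); rewrite ?mulr1n ?mulr0n; ring.
Qed.

Lemma complete_mx_proj j :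
  complete_mx K m *m lat_proj j = lat_eigenvalue K m 0 j *: lat_proj j.
Proof.
rewrite /lat_proj sum_ord2 /lat_factor /= mulmxDr -!scalemxAr.
rewrite complete_mx_sqr mulmx1.
rewrite /lat_coef /lat_eigenvalue /=; apply/matrixP => k l; rewrite !mxE.
by case: (j == 0); case: (k == l) => /=; field.
Qed.

(** The table [lat_coef] is the inverse of the table of eigenvalues.  When
    [m = 1] the complement projector vanishes, yet this inversion remains true;
    this is why the rational equations hold for every index [j]. *)
Lemma lat_coef_eigenvalue j j' :
  \sum_i lat_coef i j * lat_eigenvalue K m i j' = (j == j')%:R.
Proof.
rewrite sum_ord2 /lat_coef /lat_eigenvalue /=.
by move: j j' => [[|[|//]] ?] [[|[|//]] ?] /=; field.
Qed.
End Factor.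

Section Lattice.
Context (K : fieldType) (D : nat) (M : 'I_D -> nat).
Hypothesis M0 : forall d, (M d)%:R != 0 :> K.
Implicit Types j : {ffun 'I_D -> 'I_2}.

Definition lat_bigproj j : 'M[K]_(lat_size M) :=
  bigtens (fun d => lat_proj K (M d) (j d)).

Lemma sum_lat_bigproj : \sum_j lat_bigproj j = 1%:M.
Proof.
rewrite -(bigtens1 K M).
under [RHS]eq_bigtens do rewrite -sum_lat_proj.
have := bigtens_sum (fun _ _ => 1) (fun d i => lat_proj K (M d) i).
under [in LHS]eq_bigtens => d do under eq_bigr do rewrite scale1r.
by move=> ->; apply: eq_bigr => j _; rewrite big1 // scale1r.
Qed.

Lemma lat_adj_bigproj j :
  lat_adj K M *m lat_bigproj j =
  (\sum_d lat_eigenvalue K (M d) 0 (j d)) *: lat_bigproj j.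
Proof.
rewrite lat_adjE mulmx_suml scaler_suml; apply: eq_bigr => e _.
rewrite bigtens_mul.
rewrite (eq_bigtens (Y := fun d : 'I_D =>
    (if d == e then lat_eigenvalue K (M d) 0 (j d) else 1) *:
    lat_proj K (M d) (j d))).
  by rewrite bigtensZ (bigD1 e) //= eqxx big1 ?mulr1 // => d /negPf ->.
move=> d; case: eqVneq => _; last by rewrite mul1mx scale1r.
exact: complete_mx_proj.
Qed.

(** Coordinates of the matrix with eigenvalue [g j] on the range of
    [lat_bigproj j]. *)
Definition lat_spectral_coef (g : {ffun 'I_D -> 'I_2} -> K)
    (i : {ffun 'I_D -> 'I_2}) : K :=
  \sum_j g j * \prod_d lat_coef K (M d) (i d) (j d).

Lemma lat_spectral_coefE g :
  \sum_i lat_spectral_coef g i *: bigtens (fun d => lat_factor K (M d) (i d)) =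
  \sum_j g j *: lat_bigproj j.
Proof.
under eq_bigr do rewrite scaler_suml.
rewrite exchange_big; apply: eq_bigr => j _.
rewrite /lat_bigproj bigtens_sum scaler_sumr.
by apply: eq_bigr => i _; rewrite scalerA.
Qed.

Lemma lat_spectral_coef_eigenvalue g j :
  \sum_i lat_spectral_coef g i * \prod_d lat_eigenvalue K (M d) (i d) (j d) =
  g j.
Proof.
under eq_bigr do rewrite mulr_suml; rewrite exchange_big /=.
have sumE j' : \sum_(i : {ffun 'I_D -> 'I_2})
    g j' * (\prod_d lat_coef K (M d) (i d) (j' d)) *
    (\prod_d lat_eigenvalue K (M d) (i d) (j d)) = g j' * (j' == j)%:R.
  under eq_bigr do rewrite -mulrA -big_split /=.
  rewrite -mulr_sumr -(bigA_distr_bigA (fun d i =>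
    lat_coef K (M d) i (j' d) * lat_eigenvalue K (M d) i (j d))) /=.
  congr (_ * _); under eq_bigr do rewrite lat_coef_eigenvalue //.
  have [->|jj] := eqVneq j' j; first by rewrite big1 // => d _; rewrite eqxx.
  have /existsP[d jd] : [exists d, j' d != j d].
    apply: contraNT jj; rewrite negb_exists => /forallP jj.
    by apply/eqP/ffunP => d; apply/eqP/negbNE/jj.
  by rewrite (bigD1 d) //= (negPf jd) mul0r.
under eq_bigr do rewrite sumE.
rewrite (bigD1 j) //= eqxx mulr1 big1 ?addr0 // => j' /negPf ->.
by rewrite mulr0.
Qed.

(** Every term with some factor [K_M] has zero diagonal. *)
Lemma lat_expansion_diag (alpha : {ffun 'I_D -> 'I_2} -> K) (u : lat_node M) :
  (\sum_i alpha i *: bigtens (fun d => lat_factor K (M d) (i d)))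
    (node_index u) (node_index u) = alpha [ffun=> 1].
Proof.
rewrite summxE (bigD1 [ffun=> 1]) //= mxE bigtensE big1 ?mulr1; last first.
  by move=> d _; rewrite ffunE /lat_factor /= mxE eqxx.
rewrite big1 ?addr0 // => i i1.
have /existsP[d id] : [exists d, i d != 1].
  apply: contraNT i1; rewrite negb_exists => /forallP i1.
  by apply/eqP/ffunP => d; rewrite ffunE; apply/eqP/negbNE/i1.
rewrite mxE bigtensE (bigD1 d) //= /lat_factor.
have -> : i d = 0 by case: (i d) id => [[|[|//]] ?] // _; apply/val_inj.
by rewrite eqxx mxE eqxx mul0r mulr0.
Qed.

(** Read off the eigenvector equation for the projector on the constants, all of
    whose entries are equal. *)
Lemma lat_adj_rowsum k : \sum_l lat_adj K M k l = \sum_d ((M d)%:R - 1).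
Proof.
have := lat_adj_bigproj [ffun=> 0].
have -> : lat_bigproj [ffun=> 0] = const_mx (\prod_d (M d)%:R^-1).
  apply/matrixP => a b; have [u ->] := node_index_surj a.
  have [v ->] := node_index_surj b; rewrite bigtensE mxE.
  apply: eq_bigr => d _.
  rewrite ffunE /lat_proj sum_ord2 /lat_coef /lat_factor /= !mxE.
  by case: eqVneq => /= _; rewrite !(mulr0, mulr1, addr0, add0r).
move=> /matrixP/(_ k k); rewrite !mxE.
rewrite (eq_bigr (fun l => lat_adj K M k l * \prod_d (M d)%:R^-1)); last first.
  by move=> l _; rewrite [const_mx _ _ _]mxE.
rewrite -mulr_suml => /mulIf ->; last first.
  by apply/prodf_neq0 => d _; rewrite invr_neq0.
by apply: eq_bigr => d _; rewrite ffunE.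
Qed.

End Lattice.

(** * Vertex transitivity of the lattice graph *)

Section LatticeSymmetry.
Context (K : comPzRingType) (D : nat) (M : 'I_D -> nat).

Lemma lat_adj_perm (h : forall d, {perm 'I_(M d)}) (u v : forall d, 'I_(M d)) :
  lat_adj K M (node_index (fun d => h d (u d)))
    (node_index (fun d => h d (v d))) =
  lat_adj K M (node_index u) (node_index v).
Proof.
rewrite lat_adjE !summxE; apply: eq_bigr => j _; rewrite !bigtensE.
by apply: eq_bigr => d _; case: ifP => _; rewrite !mxE (inj_eq perm_inj).
Qed.

Lemma lat_adj_sym : (lat_adj K M)^T = lat_adj K M.
Proof.
apply/matrixP => k l; have [u ->] := node_index_surj k.
have [v ->] := node_index_surj l; rewrite mxE lat_adjE !summxE.
apply: eq_bigr => j _; rewrite !bigtensE.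
by apply: eq_bigr => d _; case: ifP => _; rewrite !mxE eq_sym.
Qed.
End LatticeSymmetry.

(** The automorphism acts on nodes as the product of the transpositions
    exchanging, in each coordinate, the values of the two nodes. *)
Lemma lat_vertex_transitive (D : nat) (M : 'I_D -> nat)
    (k l : 'I_(lat_size M)) :
  exists s : {perm 'I_(lat_size M)}, s k = l /\
    forall (K : comPzRingType) a b, lat_adj K M (s a) (s b) = lat_adj K M a b.
Proof.
have [u ->] := node_index_surj k; have [v ->] := node_index_surj l.
pose h d := tperm (u d) (v d).
pose node (a : 'I_(lat_size M)) := sval (cid (node_index_surj a)).
have nodeK a : node_index (node a) = a.
  by rewrite -(svalP (cid (node_index_surj a))).
have nodeE (w : forall d, 'I_(M d)) d : node (node_index w) d = w d.
  by apply: node_index_inj; rewrite nodeK.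
pose f a := node_index (fun d => h d (node a d)).
have f_inj : injective f.
  move=> a b /node_index_inj fab; rewrite -[a]nodeK -[b]nodeK; congr node_index.
  by apply: functional_extensionality_dep => d; exact: perm_inj (fab d).
exists (perm f_inj); split.
  rewrite permE; congr node_index; apply: functional_extensionality_dep => d.
  by rewrite nodeE tpermL.
by move=> K a b; rewrite !permE lat_adj_perm !nodeK.
Qed.

(** * The canonical system of the percolation model *)

Lemma lat_eigenvalueR (R : realType) m i j :
  lat_eigenvalue R[i] m i j = (lat_eigenvalue R m i j)%:C.
Proof.
rewrite /lat_eigenvalue; case: ifP => _ //; case: ifP => _.
  by rewrite rmorphB rmorph_nat.
by rewrite rmorphN1.
Qed.

Lemma map_lat_adj (R : realType) D (M : 'I_D -> nat) :
  map_mx (fun x : R => x%:C) (lat_adj R M) = lat_adj R[i] M.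
Proof. by apply/matrixP => a b; rewrite !mxE rmorph_nat. Qed.

(** When the diagonal is constant, the self-energy of a row is its row sum of
    variances times that constant, and all row sums are equal. *)
Lemma lat_pencil (R : realType) D (M : 'I_D -> nat) (b r : R)
    (c : 'I_(lat_size M) -> R[i] -> R[i]) (z s : R[i]) :
  (forall e, (M e)%:R != 0 :> R[i]) -> (forall k, c k z = s) ->
  girko_pencil (b *: lat_adj R M) (r *: lat_adj R M) c z =
  b%:C *: lat_adj R[i] M - (z + r%:C * (\sum_e ((M e)%:R - 1)) * s)%:M.
Proof.
move=> M0 cs; apply/matrixP => k l.
have sumE : \sum_t c t z * ((r *: lat_adj R M) l t)%:C =
    r%:C * (\sum_e ((M e)%:R - 1)) * s.
  rewrite -(lat_adj_rowsum M0 l) mulr_sumr mulr_suml.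
  apply: eq_bigr => t _; rewrite cs -map_lat_adj [in LHS]mxE [in RHS]mxE.
  by rewrite (rmorphM (real_complex R)) /= mulrC.
have BE : (b *: lat_adj R M) k l = b * lat_adj R M k l by rewrite mxE.
have CE : (b%:C *: lat_adj R[i] M) k l = b%:C * (lat_adj R M k l)%:C.
  by rewrite mxE -map_lat_adj [in LHS]mxE.
rewrite [in RHS]mxE CE !mxE sumE (rmorphM (real_complex R)) /=.
by case: (k == l); rewrite /= ?mulr1n ?mulr0n; ring.
Qed.

(** The imaginary parts of [- z] and [- q * s] have the same sign, so they
    cannot cancel. *)
Lemma denominator_neq0 (R : realType) (a q : R) (z s : R[i]) : 0 <= q ->
  complex.Im z != 0 -> 0 < complex.Im z * complex.Im s ->
  a%:C - z - q%:C * s != 0.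
Proof.
case: z => z1 z2; case: s => s1 s2 /= q0 z0 s0.
rewrite eq_complex negb_and /=; apply/orP; right.
suff : z2 * (0 - z2 - (q * s2 + 0 * s1)) < 0.
  by apply: contraTneq => e; rewrite -[_ - z2 - _]/(0 - z2 - _) ?e ?mulr0 ?ltxx.
have : 0 < z2 ^+ 2 + q * (z2 * s2).
  by rewrite ltr_pwDl ?exprn_even_gt0 // mulr_ge0 // ltW.
by rewrite -oppr_lt0; congr (_ < _); ring.
Qed.

Unset Implicit Arguments.

Theorem corollary1 (R : realType) (d : measure_display) (T : measurableType d)
    (P : probability T R) (D : nat) (M : 'I_D -> nat) (p : R)
    (D_gt0 : (0 < D)%N) (M_gt0 : forall i : 'I_D, (0 < M i)%N)
    (M_neq1 : exists i : 'I_D, M i <> 1%N) (p01 : 0 <= p <= 1)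
    (A : 'I_(lat_size M) -> 'I_(lat_size M) -> {RV P >-> R})
    (A_perc : percolation p A)
    (W : T -> 'M[R]_(lat_size M))
    (W_def : forall t, W t = (lat_degree M)%:R^-1 *: \matrix_(k, l) A k l t)
    (c : 'I_(lat_size M) -> R[i] -> R[i])
    (c_sol : girko_solution (mean_mx P W) (variance_mx P W) c)
    (F : cumulativeBounded (0 : R) (1 : R))
    (F_det : deterministic_equivalent c F) :
  forall z : R[i], complex.Im z != 0 ->
  exists alpha : {ffun 'I_D -> 'I_2} -> R[i],
    [/\ girko_mx (mean_mx P W) (variance_mx P W) c z =
          \sum_(i : {ffun 'I_D -> 'I_2})
             alpha i *: bigtens (fun e : 'I_D => lat_factor R[i] (M e) (i e)),
        stieltjes F z = alpha [ffun=> 1] &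
        forall j : {ffun 'I_D -> 'I_2},
          let den : R[i] :=
            p%:C / (lat_degree M)%:R *
               (\sum_(e < D) lat_eigenvalue R[i] (M e) 0 (j e))
            - z
            - (p * (1 - p))%:C / (lat_degree M)%:R ^+ 2 *
               (\sum_(e < D) ((M e)%:R - 1)) * alpha [ffun=> 1] in
          den != 0 /\
          \sum_(i : {ffun 'I_D -> 'I_2})
             alpha i * \prod_(e < D) lat_eigenvalue R[i] (M e) (i e) (j e)
          = den^-1].
Proof.
move=> z z0.
have N0 : (0 < lat_size M)%N by rewrite lat_sizeE prodn_gt0.
have M0 e : (M e)%:R != 0 :> R[i] by rewrite pnatr_eq0 -lt0n.
have BE := percolation_mean p01 A_perc W_def.
have VE := percolation_variance p01 A_perc W_def.
set B := mean_mx P W in BE c_sol *; set V := variance_mx P W in VE c_sol *.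
set g := (lat_degree M)%:R^-1 in BE VE.
have [p0 p1] := andP p01.
have r_ge0 : 0 <= p * (1 - p) * g ^+ 2.
  by rewrite mulr_ge0 ?sqr_ge0 // mulr_ge0 // subr_ge0.
have V0 a b : 0 <= V a b by rewrite VE !mxE mulr_ge0 // ler0n.
have Bsym : B^T = B by rewrite BE linearZ /= lat_adj_sym.
pose k0 := Ordinal N0; pose s := c k0 z.
have cs k : c k z = s.
  have [h [<- hA]] := lat_vertex_transitive k0 k.
  apply: (canonical_solution_aut k0 Bsym V0 c_sol) => //.
    by move=> a b; rewrite BE mxE hA [RHS]mxE.
  by move=> a b; rewrite VE mxE hA [RHS]mxE.
pose den (j : {ffun 'I_D -> 'I_2}) : R[i] :=
  p%:C / (lat_degree M)%:R * (\sum_(e < D) lat_eigenvalue R[i] (M e) 0 (j e))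
  - z
  - (p * (1 - p))%:C / (lat_degree M)%:R ^+ 2 *
    (\sum_(e < D) ((M e)%:R - 1)) * s.
have gC : (lat_degree M)%:R^-1 = g%:C :> R[i] by rewrite fmorphV rmorph_nat.
have rC : (p * (1 - p) * g ^+ 2)%:C = (p * (1 - p))%:C * g%:C ^+ 2.
  by rewrite (rmorphM (real_complex R)) (rmorphXn (real_complex R)).
have [cL cS] := c_sol; have [_ cE] := cS z z0.
have den0 j : den j != 0.
  have s0 : 0 < complex.Im z * complex.Im s by have [_] := cL k0 z z0.
  have -> : den j = (p * g * \sum_e lat_eigenvalue R (M e) 0 (j e))%:C - z -
      (p * (1 - p) * g ^+ 2 * (\sum_e ((M e)%:R - 1)))%:C * s.
    rewrite /den gC -exprVn gC; congr (_ - _ - _ * _).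
      under eq_bigr do rewrite lat_eigenvalueR.
      by rewrite -rmorph_sum -!rmorphM.
    rewrite [RHS](rmorphM (real_complex R)) /= rC.
    rewrite (rmorph_sum (real_complex R)); congr (_ * _).
    by apply: eq_bigr => e _; rewrite rmorphB rmorph_nat.
  have m0 : 0 <= \sum_e ((M e)%:R - 1) :> R.
    by apply: sumr_ge0 => e _; rewrite subr_ge0 ler1n.
  by apply: denominator_neq0 z0 s0; rewrite mulr_ge0.
have QE j : girko_pencil B V c z *m lat_bigproj R[i] M j =
    den j *: lat_bigproj R[i] M j.
  rewrite BE VE (lat_pencil _ _ M0 cs).
  rewrite mulmxBl -scalemxAl lat_adj_bigproj // scalerA mul_scalar_mx -scalerBl.
  congr (_ *: _); rewrite /den gC -exprVn gC rC.
  by rewrite (rmorphM (real_complex R) p g); ring.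
pose alpha := lat_spectral_coef M (fun j => (den j)^-1).
have GE : girko_mx B V c z =
    \sum_i alpha i *: bigtens (fun e => lat_factor R[i] (M e) (i e)).
  rewrite lat_spectral_coefE; apply: (mulmx1_invmx _).2.
  rewrite mulmx_sumr -(sum_lat_bigproj R[i] M); apply: eq_bigr => j _.
  by rewrite -scalemxAr QE scalerA mulVf // scale1r.
have alpha1 : alpha [ffun=> 1] = s.
  have [u k0E] := node_index_surj k0.
  by rewrite -(lat_expansion_diag alpha u) -GE -k0E -cE.
exists alpha; split => //.
  rewrite F_det // alpha1; under eq_bigr do rewrite cs.
  by rewrite sumr_const card_ord -[s *+ _]mulr_natl mulKf // pnatr_eq0 -lt0n.
move=> j; rewrite alpha1; split; first exact: den0.
exact: lat_spectral_coef_eigenvalue.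
Qed.
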